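(* Let $G$ be a finite group and let $M$ be a cut cellular surface with $n$ in and $m$ out boundary components. Let $\overline{M}$ and $M_r$ be the cut cellular surfaces obtained from $M$ by reflection in a horizontal axis and by rotation by 180 degrees, respectively. Then for all $g_1,\dots,g_n,h_1,\dots,h_m\in G$, $$\left\langle g_1,\dots,g_n\left|Z_{\overline{M}}\right|h_1,\dots,h_m\right\rangle=\left\langle h_1,\dots,h_m\left|Z_M\right|g_1,\dots,g_n\right\rangle,$$ $$\left\langle g_n^{-1},\dots,g_1^{-1}\left|Z_{M_r}\right|h_m^{-1},\dots,h_1^{-1}\right\rangle=\left\langle h_1,\dots,h_m\left|Z_M\right|g_1,\dots,g_n\right\rangle .$$
   Context: Cut cellular surfaces. A cut cellular surface (CCS) is an orientable 2-manifold $M$ with (possibly empty) boundary, endowed with a finite cell structure (0-, 1- and 2-cells), such that: (a) each boundary component of $M$ consists of a single 0-cell and a single 1-cell. (b) $M$ has a specified planar representation, obtained by cutting $M$ along 1-cells so as to obtain a simply connected region in the plane bounded by ''external'' 1-cells, namely the boundary 1-cells and the 1-cells along which $M$ was cut (''cut 1-cells''; each appears twice in the boundary of the planar region). The cut 1-cells are labelled and oriented to make explicit how they are identified in $M$. (c) The boundary components lie either along the bottom edge of the planar representation (the ''in'' components) or along the top edge (the ''out'' components); when there are no in (resp. out) components, the bottom (resp. top) edge is a single 0-cell. On the left side, on the right side, and between consecutive boundary components along the bottom and top edges there are one or more cut 1-cells, separated by 0-cells when there are more than one. (d) The planar region is made up of one or more 2-cells, separated by ''internal'' 1-cells and 0-cells.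 Colourings and invariant. Fix a finite group $G$. Orient the 1-cells of $M$: boundary 1-cells from left to right in the planar representation, cut 1-cells as specified in (b), internal 1-cells arbitrarily. A $G$-colouring of $M$ is an assignment of an element $g_i\in G$ to each 1-cell $i$ such that for each 2-cell in the planar representation, if the 1-cells of its boundary in anticlockwise order are $i_1,\dots,i_k$, then $\prod_{j=1}^k g_{i_j}^{\pm1}=1$ (flatness), where the exponent is $+1$ if the 1-cell $i_j$ is oriented compatibly with the positive (anticlockwise) orientation of the 2-cell, and $-1$ otherwise. Suppose $M$ has $n$ in and $m$ out boundary components, ordered from left to right. Let $\mathcal C(g_1,\dots,g_n;h_1,\dots,h_m)$ be the set of $G$-colourings of $M$ assigning $g_1,\dots,g_n$ to the in boundary components and $h_1,\dots,h_m$ to the out boundary components, and let $v$ be the number of internal vertices of $M$ (0-cells not lying on the boundary of $M$). The invariant is $$\langle h_1,\dots,h_m|Z_M|g_1,\dots,g_n\rangle:=\frac{1}{|G|^{\frac{m+n}{2}+v}}\,\#\mathcal C(g_1,\dots,g_n;h_1,\dots,h_m),$$ with an empty list written $\emptyset$ when there are no in (or out) components. Symmetry operations. $\overline M$ is the CCS whose planar representation is obtained from that of $M$ by reflection in a horizontal axis. $M_r$ is the CCS whose planar representation is obtained from that of $M$ by rotation by 180 degrees around an axis perpendicular to the plane. Both operations exchange the in and out boundary components. The rotation inverts the orientation of the boundary components, which is therefore adjusted after the rotation so that the boundary 1-cells of $M_r$ are again oriented from left to right. *)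

(* Defs.v *)
From mathcomp Require Import all_boot all_order all_algebra all_fingroup.
From mathcomp Require Import zify reals exp.

Set Implicit Arguments.
Unset Strict Implicit.
Unset Printing Implicit Defensive.

Variant cell_kind := Internal | Cut | In | Out.

Definition is_internal k := if k is Internal then true else false.
Definition is_cut k := if k is Cut then true else false.
Definition is_in k := if k is In then true else false.
Definition is_out k := if k is Out then true else false.
Definition is_boundary k := is_in k || is_out k.

(* [(i, true)] is the 1-cell [i] traversed along its orientation, [(i, false)]
   the same 1-cell traversed backwards. *)
Definition ocell (E : finType) : finType := (E * bool)%type.

Definition flip (E : finType) (x : ocell E) : ocell E := (x.1, ~~ x.2).

(* Combinatorial data of a planar representation, drawn in the plane with the
   anticlockwise orientation.
   - [face_word f] is the anticlockwise boundary word of the 2-cell [f].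
   - [bottom_word] and [top_word] are read from left to right, [left_word] and
     [right_word] from bottom to top.  In all four lists the 1-cells are
     nevertheless traversed as the anticlockwise boundary of the region
     traverses them, i.e., from right to left along the top and downwards along
     the left side. *)
Record ccs_data := CcsData {
  cell1 : finType;
  cell2 : finType;
  kind : cell1 -> cell_kind;
  face_word : cell2 -> seq (ocell cell1);
  bottom_word : seq (ocell cell1);
  top_word : seq (ocell cell1);
  left_word : seq (ocell cell1);
  right_word : seq (ocell cell1)
}.

Section CcsData.

Variable M : ccs_data.

Notation side := (ocell (cell1 M)).
Notation ckind x := (kind (x : side).1).

(* The oriented 1-cells that have a 2-cell on their left.  A non-boundary
   1-cell has a 2-cell on each side (M is orientable); the boundary 1-cells are
   oriented from left to right, so the region lies on the left of an in
   component and on the right of an out component. *)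
Definition is_side (x : side) : bool :=
  match ckind x with In => x.2 | Out => ~~ x.2 | _ => true end.

(* The sides bounding the planar region; a cut 1-cell contributes two. *)
Definition is_external (x : side) : bool :=
  is_side x && ~~ is_internal (ckind x).

Definition outer_word : seq side :=
  bottom_word M ++ right_word M ++ rev (top_word M) ++ rev (left_word M).

Definition follows (x y : side) : bool :=
  [exists f, (x \in face_word f) && (y == next (face_word f) x)].

(* [(x, false)] and [(x, true)] stand for the source and the target of the
   oriented 1-cell [x]. *)
Notation side_end := (side * bool)%type.

(* The 0-cells of the surface obtained from the 2-cells by gluing along the
   1-cells in [glued] are the classes of side ends generated by: the target of
   a side is the source of the next side around a 2-cell, and the source
   (resp. target) of a glued [x] is the target (resp. source) of [flip x]. *)
Definition end_rel (glued : pred (cell1 M)) : rel side_end :=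
  fun a b =>
    [|| [&& a.2, ~~ b.2 & follows a.1 b.1],
        [&& ~~ a.2, b.2 & follows b.1 a.1]
      | glued a.1.1 && (b == (flip a.1, ~~ a.2))].

Definition same_vertex (glued : pred (cell1 M)) : rel side_end :=
  connect (end_rel glued).

Definition vertices (glued : pred (cell1 M)) : {set {set side_end}} :=
  equivalence_partition (same_vertex glued) [set a | is_side a.1].

(* Gluing the internal 1-cells gives the planar region; gluing the cut 1-cells
   as well gives the surface M. *)
Definition planar_glued : pred (cell1 M) := fun i => is_internal (kind i).
Definition surface_glued : pred (cell1 M) := fun i => ~~ is_boundary (kind i).

Definition internal_vertices : {set {set side_end}} :=
  [set V in vertices surface_glued |
    [forall a in V, ~~ is_boundary (ckind a.1)]].

Definition adjacent (f f' : cell2 M) : bool :=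
  [exists x : side, [&& is_internal (ckind x), x \in face_word f
                      & flip x \in face_word f']].

Definition in_cells : seq (cell1 M) :=
  [seq x.1 | x <- bottom_word M & is_in (ckind x)].
Definition out_cells : seq (cell1 M) :=
  [seq x.1 | x <- top_word M & is_out (ckind x)].

(* Empty, or boundary 1-cells separated by one or more cut 1-cells. *)
Definition boundary_edge (P : pred cell_kind) (s : seq side) : bool :=
  [&& all (fun x => P (ckind x) || is_cut (ckind x)) s,
      sorted (fun x y => ~~ (P (ckind x) && P (ckind y))) s
    & if s is x :: s' then P (ckind x) && P (ckind (last x s')) else true].

Definition lateral_edge (s : seq side) : bool :=
  (s != [::]) && all (fun x => is_cut (ckind x)) s.

Record is_ccs (n m : nat) : Prop := IsCcs {
  face_word_nonempty : forall f : cell2 M, face_word f != [::];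
  face_word_sides :
    forall x : side, \sum_(f : cell2 M) count_mem x (face_word f) = is_side x;
  (* The next four fields say that the planar region is a disc whose boundary
     is [outer_word]: it is connected, has Euler characteristic 1, and its
     external sides form the single closed path [outer_word].  As the 0-cells
     are classes of ends under gluing around corners, every 0-cell on the
     boundary of the region is the target of exactly one external side and the
     source of exactly one. *)
  region_connected : forall f f' : cell2 M, connect adjacent f f';
  region_euler :
    #|vertices planar_glued| + #|cell2 M|
      = #|planar_glued| + size outer_word + 1;
  outer_word_sides : forall x : side, count_mem x outer_word = is_external x;
  outer_word_closed :
    path.cycle (fun x y => same_vertex planar_glued (x, true) (y, false))
      outer_word;
  bottom_shape : boundary_edge is_in (bottom_word M);
  top_shape : boundary_edge is_out (top_word M);
  left_shape : lateral_edge (left_word M);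
  right_shape : lateral_edge (right_word M);
  (* Each boundary component is a single 1-cell with a single 0-cell: a 0-cell
     on the boundary of M meets exactly two ends of boundary sides, so a
     boundary 1-cell whose ends agree is a whole boundary component. *)
  boundary_loop :
    forall x : side, is_side x -> is_boundary (ckind x) ->
      same_vertex surface_glued (x, false) (x, true);
  size_in_cells : size in_cells = n;
  size_out_cells : size out_cells = m
}.

End CcsData.

Record ccs (n m : nat) := Ccs {
  ccs_val :> ccs_data;
  ccsP : is_ccs ccs_val n m
}.

Definition swap_kind k :=
  match k with In => Out | Out => In | Internal => Internal | Cut => Cut end.

(* A reflection in a horizontal axis reverses the plane orientation, hence
   traverses every boundary word backwards; left and right, and the
   orientations of the 1-cells, are preserved. *)
Definition reflect_data (M : ccs_data) : ccs_data :=
  @CcsData (cell1 M) (cell2 M)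
    (fun i => swap_kind (kind i))
    (fun f => rev (map (@flip _) (face_word f)))
    (map (@flip _) (top_word M)) (map (@flip _) (bottom_word M))
    (rev (map (@flip _) (left_word M))) (rev (map (@flip _) (right_word M))).

(* A rotation by 180 degrees preserves the plane orientation, hence the boundary
   words; only the boundary 1-cells change orientation, so as to run again from
   left to right. *)
Definition reorient (M : ccs_data) (x : ocell (cell1 M)) : ocell (cell1 M) :=
  if is_boundary (kind x.1) then flip x else x.

Definition rotate_data (M : ccs_data) : ccs_data :=
  @CcsData (cell1 M) (cell2 M)
    (fun i => swap_kind (kind i))
    (fun f => map (@reorient M) (face_word f))
    (rev (map (@reorient M) (top_word M)))
    (rev (map (@reorient M) (bottom_word M)))
    (rev (map (@reorient M) (right_word M)))
    (rev (map (@reorient M) (left_word M))).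

Section Symmetry.

Lemma connect_inv (T : finType) (e e' : rel T) (t : T -> T) :
  involutive t -> (forall a b, e' (t a) (t b) = e a b) ->
  forall a b, connect e' (t a) (t b) = connect e a b.
Proof.
move=> tK tE.
have sub (r r' : rel T) : (forall a b, r' (t a) (t b) = r a b) ->
    forall a b, connect r a b -> connect r' (t a) (t b).
  move=> rE a b /connectP[p pp ->]; apply/connectP.
  exists (map t p); last by rewrite last_map.
  by rewrite path_map (eq_path (e' := r)) // => x y /=; rewrite rE.
move=> a b; apply/idP/idP; last exact: sub.
move=> h; rewrite -[a]tK -[b]tK; apply: (sub e' e) h => x y.
by rewrite -tE !tK.
Qed.

Lemma equivalence_partition_inv (T : finType) (r r' : rel T) (t : T -> T)
    (D D' : {set T}) :
  involutive t -> (forall a b, r' (t a) (t b) = r a b) ->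
  (forall a, (t a \in D') = (a \in D)) ->
  equivalence_partition r' D' =
    [set t @: (V : {set T}) | V in equivalence_partition r D].
Proof.
move=> tK rE DE.
have t_inj : injective t := can_inj tK.
have classE a : [set y in D' | r' (t a) y] = t @: [set y in D | r a y].
  apply/setP=> y; rewrite -[y]tK (mem_imset _ _ t_inj).
  by rewrite [LHS]in_set [RHS]in_set rE DE.
apply/setP=> V; apply/imsetP/imsetP.
  case=> a aD ->; exists [set y in D | r (t a) y].
    by apply: imset_f; rewrite -DE tK.
  by rewrite -classE tK.
case=> W /imsetP[a aD ->] ->; exists (t a); first by rewrite DE.
by rewrite classE.
Qed.


Lemma count_rot (T : Type) (p : pred T) k (s : seq T) :
  count p (rot k s) = count p s.
Proof. by rewrite /rot count_cat addnC -count_cat cat_take_drop. Qed.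

Section Data.

Variable M : ccs_data.

Notation side := (ocell (cell1 M)).

Lemma same_vertexC gl : symmetric (@same_vertex M gl).
Proof.
apply: sym_connect_sym => -[[i s] p] [[j t] q].
rewrite /end_rel /flip /= orbCA; congr [|| _, _ | _].
- by rewrite andbCA.
- by rewrite andbCA.
rewrite !xpair_eqE; case: (i =P j) => [->|ij]; last first.
  by rewrite (introF eqP (fun e => ij (esym e))) !andbF.
by rewrite eqxx; case: s p t q => -[] [] [].
Qed.

Lemma boundary_edge_rev P s : boundary_edge P (rev s) = @boundary_edge M P s.
Proof.
rewrite /boundary_edge all_rev rev_sorted; congr [&& _, _ & _].
  by apply: eq_sorted => x y /=; rewrite andbC.
case: s => // x s; case/lastP: s => // s y.
by rewrite rev_cons rev_rcons /= !last_rcons andbC.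
Qed.

Lemma boundary_edge_map (M' : ccs_data) (t : side -> ocell (cell1 M')) P P' s :
  (forall x, P' (kind (t x).1) = P (kind x.1)) ->
  (forall x, is_cut (kind (t x).1) = is_cut (kind x.1)) ->
  boundary_edge P' (map t s) = boundary_edge P s.
Proof.
move=> tP tC; rewrite /boundary_edge all_map sorted_map.
congr [&& _, _ & _].
- by apply: eq_all => x /=; rewrite tP tC.
- by apply: eq_sorted => x y /=; rewrite !tP.
- by case: s => //= x s; rewrite last_map !tP.
Qed.

Lemma lateral_edge_rev_map (M' : ccs_data) (t : side -> ocell (cell1 M')) s :
  (forall x, is_cut (kind (t x).1) = is_cut (kind x.1)) ->
  lateral_edge (rev (map t s)) = lateral_edge s.
Proof.
move=> tC; rewrite /lateral_edge all_rev all_map -!size_eq0 size_rev size_map.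
by congr (_ && _); apply: eq_all => x /=; rewrite tC.
Qed.

End Data.

Section Ccs.

Variables (n m : nat) (M : ccs n m).

Notation side := (ocell (cell1 M)).

Lemma flipK : involutive (@flip (cell1 M)).
Proof. by case=> i b; rewrite /flip /= negbK. Qed.

Lemma reorientK : involutive (@reorient M).
Proof.
by move=> x; rewrite /reorient; case E: (is_boundary (kind x.1)) => /=;
  rewrite E ?flipK.
Qed.

Lemma reorient1 x : (@reorient M x).1 = x.1.
Proof. by rewrite /reorient; case: ifP. Qed.

Lemma reorient_flip x : @reorient M (flip x) = flip (@reorient M x).
Proof. by rewrite /reorient /=; case: ifP. Qed.

Lemma count_mem_inv (t : side -> side) x s :
  involutive t -> count_mem x (map t s) = count_mem (t x) s.
Proof.
move=> tK; rewrite seq.count_map; apply: eq_count => y /=.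
by apply/eqP/eqP => [<-|->]; rewrite tK.
Qed.

Lemma face_word_uniq (f : cell2 M) : uniq (face_word f).
Proof.
apply: count_mem_uniq => x.
have := face_word_sides (ccsP M) x; rewrite (bigD1 f) //=.
rewrite -has_pred1 has_count.
by case: (is_side x); case: (count_mem x (face_word f)) => [|[|k]] //; lia.
Qed.

Lemma is_boundary_swap k : is_boundary (swap_kind k) = is_boundary k.
Proof. by case: k. Qed.
Lemma is_internal_swap k : is_internal (swap_kind k) = is_internal k.
Proof. by case: k. Qed.
Lemma is_cut_swap k : is_cut (swap_kind k) = is_cut k.
Proof. by case: k. Qed.
Lemma is_in_swap k : is_in (swap_kind k) = is_out k.
Proof. by case: k. Qed.
Lemma is_out_swap k : is_out (swap_kind k) = is_in k.
Proof. by case: k. Qed.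

Lemma surface_glued_reflect : @surface_glued (reflect_data M) =1 @surface_glued M.
Proof. by move=> i; rewrite /surface_glued /= is_boundary_swap. Qed.
Lemma surface_glued_rotate : @surface_glued (rotate_data M) =1 @surface_glued M.
Proof. by move=> i; rewrite /surface_glued /= is_boundary_swap. Qed.
Lemma planar_glued_reflect : @planar_glued (reflect_data M) =1 @planar_glued M.
Proof. by move=> i; rewrite /planar_glued /= is_internal_swap. Qed.
Lemma planar_glued_rotate : @planar_glued (rotate_data M) =1 @planar_glued M.
Proof. by move=> i; rewrite /planar_glued /= is_internal_swap. Qed.

Lemma is_side_reflect (x : side) :
  @is_side (reflect_data M) (flip x) = is_side x.
Proof. by rewrite /is_side /=; case: (kind x.1) => //=; rewrite negbK. Qed.

Lemma is_side_rotate (x : side) :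
  @is_side (rotate_data M) (reorient x) = is_side x.
Proof.
rewrite /is_side /reorient; case E: (kind x.1) => /=; rewrite ?E //=.
exact: negbK.
Qed.

Definition reflect_end (a : side * bool) : side * bool := (flip a.1, ~~ a.2).
Definition rotate_end (a : side * bool) : side * bool := (reorient a.1, a.2).

Lemma reflect_endK : involutive reflect_end.
Proof. by case=> x b; rewrite /reflect_end /= flipK negbK. Qed.
Lemma rotate_endK : involutive rotate_end.
Proof. by case=> x b; rewrite /rotate_end /= reorientK. Qed.

Lemma mem_map_inv (t : side -> side) x s :
  involutive t -> (x \in map t s) = (t x \in s).
Proof. by move=> tK; rewrite -{1}[x]tK mem_map //; exact: can_inj tK. Qed.

Lemma follows_reflect (x y : side) :
  @follows (reflect_data M) (flip y) (flip x) = follows x y.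
Proof.
apply: eq_existsb => f /=.
have fi := can_inj flipK; have u := face_word_uniq f.
rewrite mem_rev mem_map // next_rev ?map_inj_uniq // prev_map // (inj_eq fi).
apply/andP/andP => -[h /eqP e].
  by rewrite e mem_prev h next_prev.
by rewrite e mem_next h prev_next.
Qed.

Lemma follows_rotate (x y : side) :
  @follows (rotate_data M) (reorient x) (reorient y) = follows x y.
Proof.
apply: eq_existsb => f /=.
have fi := can_inj reorientK; have u := face_word_uniq f.
by rewrite mem_map // next_map // (inj_eq fi).
Qed.

Lemma end_rel_reflect gl gl' : gl' =1 gl -> forall a b,
  @end_rel (reflect_data M) gl' (reflect_end a) (reflect_end b) =
  @end_rel M gl a b.
Proof.
move=> glE a b; rewrite /end_rel; rewrite /= !negbK !follows_reflect orbCA.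
congr [|| _, _ | _]; rewrite glE; congr (_ && _).
have := inj_eq (can_inj reflect_endK) b (flip a.1, ~~ a.2).
by rewrite {2}/reflect_end /= negbK.
Qed.

Lemma end_rel_rotate gl gl' : gl' =1 gl -> forall a b,
  @end_rel (rotate_data M) gl' (rotate_end a) (rotate_end b) =
  @end_rel M gl a b.
Proof.
move=> glE a b; rewrite /end_rel /= !follows_rotate; congr [|| _, _ | _].
rewrite reorient1 glE -reorient_flip; congr (_ && _).
exact: (inj_eq (can_inj rotate_endK) b (flip a.1, ~~ a.2)).
Qed.

Lemma same_vertex_reflect gl gl' : gl' =1 gl -> forall a b,
  @same_vertex (reflect_data M) gl' (reflect_end a) (reflect_end b) =
  @same_vertex M gl a b.
Proof. by move=> glE; apply: connect_inv reflect_endK (end_rel_reflect glE). Qed.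

Lemma same_vertex_rotate gl gl' : gl' =1 gl -> forall a b,
  @same_vertex (rotate_data M) gl' (rotate_end a) (rotate_end b) =
  @same_vertex M gl a b.
Proof. by move=> glE; apply: connect_inv rotate_endK (end_rel_rotate glE). Qed.

Lemma vertices_reflect gl gl' : gl' =1 gl ->
  @vertices (reflect_data M) gl' =
    [set reflect_end @: (V : {set _}) | V in @vertices M gl].
Proof.
move=> glE; apply: equivalence_partition_inv reflect_endK _ _.
  exact: same_vertex_reflect.
by move=> a; rewrite !inE; exact: is_side_reflect.
Qed.

Lemma vertices_rotate gl gl' : gl' =1 gl ->
  @vertices (rotate_data M) gl' =
    [set rotate_end @: (V : {set _}) | V in @vertices M gl].
Proof.
move=> glE; apply: equivalence_partition_inv rotate_endK _ _.
  exact: same_vertex_rotate.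
by move=> a; rewrite !inE; exact: is_side_rotate.
Qed.

Lemma outer_word_reflect :
  @outer_word (reflect_data M) =
    rot (size (left_word M)) (rev (map (@flip _) (outer_word M))).
Proof.
rewrite /outer_word !map_cat !rev_cat !map_rev !revK -!catA.
by rewrite -(size_map (@flip _) (left_word M)) rot_size_cat -!catA.
Qed.

Lemma outer_word_rotate :
  @outer_word (rotate_data M) =
    rot (size (bottom_word M ++ right_word M)) (map (@reorient _) (outer_word M)).
Proof.
rewrite /outer_word [X in map _ X]catA map_cat.
by rewrite -(size_map (@reorient M)) rot_size_cat !map_cat !map_rev /= !revK -!catA.
Qed.

Lemma in_cells_reflect : @in_cells (reflect_data M) = out_cells M.
Proof.
rewrite /in_cells /out_cells /= filter_map -map_comp; congr map.
by apply: eq_filter => x /=; rewrite is_in_swap.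
Qed.

Lemma out_cells_reflect : @out_cells (reflect_data M) = in_cells M.
Proof.
rewrite /in_cells /out_cells /= filter_map -map_comp; congr map.
by apply: eq_filter => x /=; rewrite is_out_swap.
Qed.

Lemma in_cells_rotate : @in_cells (rotate_data M) = rev (out_cells M).
Proof.
rewrite /in_cells /out_cells /= filter_rev filter_map map_rev -map_comp.
congr rev; rewrite (eq_map reorient1); congr map.
by apply: eq_filter => x /=; rewrite reorient1 is_in_swap.
Qed.

Lemma out_cells_rotate : @out_cells (rotate_data M) = rev (in_cells M).
Proof.
rewrite /in_cells /out_cells /= filter_rev filter_map map_rev -map_comp.
congr rev; rewrite (eq_map reorient1); congr map.
by apply: eq_filter => x /=; rewrite reorient1 is_out_swap.
Qed.

Lemma adjacent_reflect f f' : @adjacent (reflect_data M) f f' = @adjacent M f f'.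
Proof.
rewrite /adjacent /=; apply/existsP/existsP => -[x /and3P[h1 h2 h3]];
  exists (flip x).
- move: h1 h2 h3; rewrite /= is_internal_swap !mem_rev !mem_map_inv; try exact: flipK.
  by rewrite flipK => -> -> ->.
- rewrite /= is_internal_swap !mem_rev !mem_map_inv; try exact: flipK.
  by rewrite flipK h1 h2 h3.
Qed.

Lemma adjacent_rotate f f' : @adjacent (rotate_data M) f f' = @adjacent M f f'.
Proof.
rewrite /adjacent /=; apply: eq_existsb => x.
rewrite is_internal_swap !mem_map_inv; try exact: reorientK.
by rewrite /reorient /=; case: (kind x.1).
Qed.

Lemma reflect_ccsP : is_ccs (reflect_data M) m n.
Proof.
have [fn fs rc re os oc bs ts ls rs bl si so] := ccsP M.
have sideE x : @is_side M (flip x) = @is_side (reflect_data M) x.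
  by rewrite -{2}[x]flipK is_side_reflect.
split.
- by move=> f; rewrite /= -size_eq0 size_rev size_map size_eq0.
- move=> x; rewrite -sideE -fs; apply: eq_bigr => f _.
  by rewrite /= count_rev count_mem_inv //; exact: flipK.
- move=> f f'; rewrite (eq_connect adjacent_reflect); exact: rc.
- rewrite (vertices_reflect planar_glued_reflect) card_imset; last first.
    exact/imset_inj/can_inj/reflect_endK.
  rewrite (eq_card (B := @planar_glued M)); last exact: planar_glued_reflect.
  by rewrite outer_word_reflect size_rot size_rev size_map.
- move=> x; rewrite outer_word_reflect.
  rewrite count_rot count_rev count_mem_inv ?os; last exact: flipK.
  by rewrite /is_external sideE /= is_internal_swap.
- rewrite outer_word_reflect rot_cycle rev_cycle cycle_map.
  rewrite (eq_cycle (e' := fun x y => same_vertex (@planar_glued M) (x, true) (y, false))) //.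
  move=> x y /=; rewrite /relpre /= -(same_vertex_reflect planar_glued_reflect).
  by rewrite same_vertexC.
- rewrite /= (@boundary_edge_map M (reflect_data M) _ is_out) // => x /=;
    by rewrite ?is_in_swap ?is_cut_swap.
- rewrite /= (@boundary_edge_map M (reflect_data M) _ is_in) // => x /=;
    by rewrite ?is_out_swap ?is_cut_swap.
- rewrite /= (@lateral_edge_rev_map M (reflect_data M)) // => x /=;
    by rewrite is_cut_swap.
- rewrite /= (@lateral_edge_rev_map M (reflect_data M)) // => x /=;
    by rewrite is_cut_swap.
- move=> x; rewrite /= is_boundary_swap -sideE => xs xb.
  have := bl _ xs xb; rewrite -(same_vertex_reflect surface_glued_reflect).
  by rewrite same_vertexC /reflect_end /= flipK.
- by rewrite in_cells_reflect.
- by rewrite out_cells_reflect.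
Qed.

Lemma rotate_ccsP : is_ccs (rotate_data M) m n.
Proof.
have [fn fs rc re os oc bs ts ls rs bl si so] := ccsP M.
have sideE x : @is_side M (reorient x) = @is_side (rotate_data M) x.
  by rewrite -{2}[x]reorientK is_side_rotate.
split.
- by move=> f; rewrite /= -size_eq0 size_map size_eq0.
- move=> x; rewrite -sideE -fs; apply: eq_bigr => f _.
  by rewrite /= count_mem_inv //; exact: reorientK.
- move=> f f'; rewrite (eq_connect adjacent_rotate); exact: rc.
- rewrite (vertices_rotate planar_glued_rotate) card_imset; last first.
    exact/imset_inj/can_inj/rotate_endK.
  rewrite (eq_card (B := @planar_glued M)); last exact: planar_glued_rotate.
  by rewrite outer_word_rotate size_rot size_map.
- move=> x; rewrite outer_word_rotate.
  rewrite count_rot count_mem_inv ?os; last exact: reorientK.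
  by rewrite /is_external sideE /= reorient1 is_internal_swap.
- rewrite outer_word_rotate rot_cycle cycle_map.
  rewrite (eq_cycle (e' := fun x y => same_vertex (@planar_glued M) (x, true) (y, false))) //.
  by move=> x y /=; rewrite /relpre /= -(same_vertex_rotate planar_glued_rotate).
- rewrite /= boundary_edge_rev (@boundary_edge_map M (rotate_data M) _ is_out) // => x /=;
    by rewrite reorient1 ?is_in_swap ?is_cut_swap.
- rewrite /= boundary_edge_rev (@boundary_edge_map M (rotate_data M) _ is_in) // => x /=;
    by rewrite reorient1 ?is_out_swap ?is_cut_swap.
- rewrite /= (@lateral_edge_rev_map M (rotate_data M)) // => x /=;
    by rewrite reorient1 is_cut_swap.
- rewrite /= (@lateral_edge_rev_map M (rotate_data M)) // => x /=;
    by rewrite reorient1 is_cut_swap.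
- move=> x; rewrite /= is_boundary_swap -sideE => xs xb.
  have := bl (@reorient M x) xs; rewrite reorient1 => /(_ xb).
  rewrite -(same_vertex_rotate surface_glued_rotate).
  by rewrite /rotate_end /= reorientK.
- by rewrite in_cells_rotate size_rev.
- by rewrite out_cells_rotate size_rev.
Qed.

End Ccs.

End Symmetry.

Definition reflection n m (M : ccs n m) : ccs m n := Ccs (reflect_ccsP M).
Definition rotation n m (M : ccs n m) : ccs m n := Ccs (rotate_ccsP M).

Section Invariant.

Variables (R : realType) (gT : finGroupType) (n m : nat) (M : ccs n m).

Definition signed_colour (c : {ffun cell1 M -> gT}) (x : ocell (cell1 M)) :
    gT :=
  if x.2 then c x.1 else (c x.1)^-1%g.

Definition flat (c : {ffun cell1 M -> gT}) : bool :=
  [forall f : cell2 M, (\prod_(x <- face_word f) signed_colour c x == 1)%g].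

Definition colourings (g : n.-tuple gT) (h : m.-tuple gT) :
    {set {ffun cell1 M -> gT}} :=
  [set c | [&& flat c, map c (in_cells M) == g & map c (out_cells M) == h]].

(* <h_1,...,h_m | Z_M | g_1,...,g_n> *)
Definition matrix_element (h : m.-tuple gT) (g : n.-tuple gT) : R :=
  (#|colourings g h|%:R /
     powR #|gT|%:R ((m + n)%:R / 2%:R + #|internal_vertices M|%:R))%R.

End Invariant.

(* Main.v *)
(** A reflection reverses every boundary word and inverts its letters, which
    inverts the product around each 2-cell, so the two surfaces have the same
    colourings.  A rotation changes only the orientation of the boundary 1-cells,
    so inverting the colours of those 1-cells is a bijection of colourings.  Both
    operations permute the ends of 1-cells compatibly with the gluings, hence
    preserve the number of internal vertices. *)
Require Import Defs.
From mathcomp Require Import all_boot all_order all_algebra all_fingroup.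
From mathcomp Require Import reals exp.

Section Symmetry.

Variables (gT : finGroupType) (n m : nat) (M : ccs n m).

Notation side_end := (ocell (cell1 M) * bool)%type.

(** Taking direct images under [t] is injective on sets of ends. Since [t] respects lying on a
    boundary 1-cell, it matches the internal vertices of the two surfaces. *)
Lemma card_internal_vertices_inv (M' : ccs_data)
    (t : side_end -> ocell (cell1 M') * bool) :
  injective t ->
  (forall a, is_boundary (kind (t a).1.1) = is_boundary (kind a.1.1)) ->
  vertices (@surface_glued M') =
    [set t @: (V : {set _}) | V in vertices (@surface_glued M)] ->
  #|internal_vertices M'| = #|internal_vertices M|.
Proof.
move=> t_inj tB vE.
rewrite -(card_imset _ (imset_inj t_inj)); apply: eq_card => W.
have interiorE (V : {set side_end}) :
    [forall a in t @: V, ~~ is_boundary (kind a.1.1)] =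
    [forall a in V, ~~ is_boundary (kind a.1.1)].
  apply/forall_inP/forall_inP => [VP a aV | VP _ /imsetP[a aV ->]].
    by rewrite -tB; apply/VP/imset_f.
  by rewrite tB VP.
rewrite inE vE; apply/andP/imsetP.
  case=> /imsetP[V Vv ->]; rewrite interiorE => VP.
  by exists V; rewrite // inE Vv.
case=> V; rewrite inE => /andP[Vv VP] ->.
by rewrite interiorE; split; first exact: imset_f.
Qed.

Lemma card_internal_vertices_reflection :
  #|internal_vertices (reflection M)| = #|internal_vertices M|.
Proof.
apply: (@card_internal_vertices_inv (reflection M) (@reflect_end n m M)).
- exact: can_inj (@reflect_endK n m M).
- by move=> a; rewrite /= is_boundary_swap.
- exact: vertices_reflect (@surface_glued_reflect n m M).
Qed.

Lemma card_internal_vertices_rotation :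
  #|internal_vertices (rotation M)| = #|internal_vertices M|.
Proof.
apply: (@card_internal_vertices_inv (rotation M) (@rotate_end n m M)).
- exact: can_inj (@rotate_endK n m M).
- by move=> a; rewrite /= is_boundary_swap reorient1.
- exact: vertices_rotate (@surface_glued_rotate n m M).
Qed.

Implicit Type c : {ffun cell1 M -> gT}.

(** Inversion is an antihomomorphism, so the reversal of a reflected face word is exactly what a
    nonabelian group requires. *)
Lemma prodg_rev_inv (T : Type) (F : T -> gT) (s : seq T) :
  (\prod_(x <- rev s) (F x)^-1 = (\prod_(x <- s) F x)^-1)%g.
Proof.
elim: s => [|x s IH]; first by rewrite !big_nil invg1.
by rewrite rev_cons big_rcons IH big_cons invMg.
Qed.

Lemma flat_reflection c : @flat gT m n (reflection M) c = flat c.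
Proof.
apply: eq_forallb => f /=; rewrite -map_rev big_map.
(* Flipping a side inverts its signed colour. *)
rewrite (eq_bigr (fun x => (signed_colour c x)^-1%g)).
  by rewrite prodg_rev_inv invg_eq1.
by case=> i [] _; rewrite /signed_colour //= invgK.
Qed.

Lemma colourings_reflection (g : n.-tuple gT) (h : m.-tuple gT) :
  colourings (reflection M) h g = colourings M g h.
Proof.
apply/setP=> c; rewrite !inE flat_reflection.
have -> : in_cells (reflection M) = out_cells M by exact: in_cells_reflect.
have -> : out_cells (reflection M) = in_cells M by exact: out_cells_reflect.
by rewrite [X in _ && X]andbC.
Qed.

Definition invert_boundary c : {ffun cell1 M -> gT} :=
  [ffun i => if is_boundary (kind i) then (c i)^-1%g else c i].

Lemma invert_boundaryK : involutive invert_boundary.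
Proof.
by move=> c; apply/ffunP=> i; rewrite !ffunE; case: ifP => ->; rewrite ?invgK.
Qed.

(** On a boundary 1-cell the sign changed by [reorient] cancels the inverted colour, so every letter
    of a face word keeps its value. *)
Lemma flat_rotation c :
  @flat gT m n (rotation M) (invert_boundary c) = flat c.
Proof.
apply: eq_forallb => f /=; rewrite big_map; congr (_ == _).
by apply: eq_bigr => -[i []] _; rewrite /signed_colour /reorient /=;
  case iB: (is_boundary (kind i)); rewrite /= ffunE iB ?invgK.
Qed.

Lemma map_invert_boundary c (s : seq (cell1 M)) :
  all (fun i => is_boundary (kind i)) s ->
  map (invert_boundary c) s = [seq x^-1%g | x <- map c s].
Proof.
move=> /allP sB; rewrite -map_comp; apply/eq_in_map => i /sB iB.
by rewrite ffunE iB.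
Qed.

Lemma in_cells_boundary : all (fun i => is_boundary (kind i)) (in_cells M).
Proof.
apply/allP=> _ /mapP[x + ->]; rewrite mem_filter => /andP[xI _].
by rewrite /is_boundary xI.
Qed.

Lemma out_cells_boundary : all (fun i => is_boundary (kind i)) (out_cells M).
Proof.
apply/allP=> _ /mapP[x + ->]; rewrite mem_filter => /andP[xO _].
by rewrite /is_boundary xO orbT.
Qed.

Lemma card_colourings_rotation (g : n.-tuple gT) (h : m.-tuple gT) :
  #|colourings (rotation M) [tuple of rev [seq x^-1%g | x <- h]]
                            [tuple of rev [seq x^-1%g | x <- g]]|
    = #|colourings M g h|.
Proof.
(* Replacing the right-hand set by its image under [invert_boundary] reduces the count to an
   equality of sets, tested on colourings of the form [invert_boundary c]. *)
rewrite -[RHS](card_imset _ (can_inj invert_boundaryK)); apply: eq_card => c.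
rewrite -[c]invert_boundaryK (mem_imset _ _ (can_inj invert_boundaryK)).
move: (invert_boundary c) => {}c; rewrite !inE flat_rotation.
have -> : in_cells (rotation M) = rev (out_cells M) by exact: in_cells_rotate.
have -> : out_cells (rotation M) = rev (in_cells M) by exact: out_cells_rotate.
rewrite !map_rev !map_invert_boundary ?in_cells_boundary ?out_cells_boundary //=.
(* Reversal after entrywise inversion is injective, so it cancels from both boundary conditions. *)
have rev_map_inj := inj_comp (can_inj (@revK gT)) (inj_map (@invg_inj gT)).
by rewrite !(inj_eq rev_map_inj) [X in _ && X]andbC.
Qed.

End Symmetry.

Theorem proposition6p1 (R : realType) (gT : finGroupType) (n m : nat)
    (M : ccs n m) (g : n.-tuple gT) (h : m.-tuple gT) :
  matrix_element R (reflection M) g h = matrix_element R M h g /\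
  matrix_element R (rotation M)
      [tuple of rev [seq (x^-1)%g | x <- g]]
      [tuple of rev [seq (x^-1)%g | x <- h]]
    = matrix_element R M h g.
Proof.
(* Both operations exchange [n] and [m]; commutativity makes the exponents of the order of the group
   agree. *)
split; rewrite /matrix_element addnC.
  by rewrite colourings_reflection card_internal_vertices_reflection.
by rewrite card_colourings_rotation card_internal_vertices_rotation.
Qed.
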